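(* Let $X \subseteq \omega_1$ be a stationary set. Then the poset $(\mathcal{P}(X)/\!=_E, \leq_d)$ contains uncountable anti-chains and uncountable strictly descending chains.
   Context: $\omega_1$ is the first uncountable ordinal with the order topology, and subsets of $\omega_1$ carry the subspace topology. A set $S \subseteq \omega_1$ is stationary if $S$ intersects every closed and unbounded subset of $\omega_1$. For topological spaces $A, B$ write $A <_E B$ if $A$ is homeomorphic to a subspace of $B$, and $A =_E B$ if $A <_E B$ and $B <_E A$. $\mathcal{P}(X)/\!=_E$ is the set of equivalence classes $[A] = \{B \subseteq X : B =_E A\}$ for $A \subseteq X$, partially ordered by $[A] \leq_d [B]$ iff $A <_E B$. An anti-chain is a set of pairwise incomparable elements. An uncountable strictly descending chain is a family $([A_\beta])_{\beta<\omega_1}$ such that $[A_\gamma] \leq_d [A_\beta]$ and $[A_\gamma] \neq [A_\beta]$ whenever $\beta < \gamma < \omega_1$. *)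

(* Defs.v *)
From HB Require Import structures.
From mathcomp Require Import all_boot all_order.
From mathcomp Require Import all_classical wochoice topology.
Set Implicit Arguments.
Unset Strict Implicit.
Unset Printing Implicit Defensive.
Import Order.TTheory.
Local Open Scope classical_set_scope.
Local Open Scope order_scope.

(* An uncountable well-order all of whose proper initial segments are
   countable, i.e. a copy of the first uncountable ordinal; see
   omega1_exists below.  For W : orderTopologicalType d the topology of W is
   the order topology. *)
Record is_omega1 d (W : orderType d) : Prop := IsOmega1 {
  omega1_well_order : well_order (<=%O : rel W);
  omega1_uncountable : ~ countable [set: W];
  omega1_initial_countable : forall x : W, countable [set y : W | y < x] }.

Definition stationary d (W : orderTopologicalType d) (S : set W) :=
  forall C : set W, closed C -> ~ has_ubound C -> S `&` C !=set0.

Definition homeomorphic (S T : topologicalType) :=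
  exists (f : S -> T) (g : T -> S),
    [/\ cancel f g, cancel g f, continuous f & continuous g].

(* Sets are coerced to types (set_type), which carry the subspace topology. *)
Definition embeds (S T : topologicalType) :=
  exists C : set T, homeomorphic S C.

Notation "A <_E B" := (embeds A B) (at level 70, no associativity).

Definition biembeds (S T : topologicalType) := S <_E T /\ T <_E S.

Notation "A =_E B" := (biembeds A B) (at level 70, no associativity).

Lemma embedsP (S T : topologicalType) :
  S <_E T <-> exists f : S -> T, [/\ injective f, continuous f &
    forall U, open U -> exists2 V, open V & f @^-1` V = U].
Proof.
split=> [[C [f [g [fK gK cf cg]]]]|[f [fI cf fO]]].
  exists (fun s => set_val (f s)); split.
  - by move=> x y /val_inj /(can_inj fK).
  - move=> s; apply: (@continuous_comp S C T f set_val); first exact: cf.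
    exact: initial_continuous.
  - move=> U oU; have : open (g @^-1` U) by move/continuousP: cg; apply.
    case=> V oV VgU; exists V => //.
    have -> : U = f @^-1` (g @^-1` U) by apply/seteqP; split=> x /=; rewrite fK.
    by rewrite -VgU.
have fC s : f s \in range f := mem_set (imageT f s).
have fP (y : range f) : {s | f s = set_val y}.
  by apply: cid; have [s _ fs] := set_valP y; exists s.
exists (range f), (fun s => exist _ (f s) (fC s)), (fun y => sval (fP y)).
split.
- by move=> s; case: (fP _) => /= s' /fI.
- by move=> y; case: (fP y) => s fsy; exact/val_inj.
- by apply/continuousP => _ [V oV <-]; move/continuousP: cf => /(_ V oV).
- apply/continuousP => U /fO[V oV <-]; exists V => //.
  by apply/seteqP; split=> y /=; case: (fP y) => s /= ->.
Qed.

Lemma embeds_refl (S : topologicalType) : S <_E S.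
Proof.
by apply/embedsP; exists id; split=> [//|x|U oU]; [exact: cvg_id|exists U].
Qed.

Lemma embeds_trans (S T U : topologicalType) : S <_E T -> T <_E U -> S <_E U.
Proof.
move=> /embedsP[f [fI cf fO]] /embedsP[g [gI cg gO]]; apply/embedsP.
exists (g \o f); split; first exact: inj_comp.
  by move=> s; apply: continuous_comp; [exact: cf|exact: cg].
by move=> A /fO[V /gO[B oB <-] <-]; exists B.
Qed.

Section equot.
Context {T : topologicalType} (X : set T).
Implicit Types A B : set T.

Definition eclass A : set (set T) := [set B | B `<=` X /\ B =_E A].

(* P(X)/=_E, literally a type of sets of subsets of X *)
Definition equot := set_type [set eclass A | A in [set A | A `<=` X]].

HB.instance Definition _ := Choice.on equot.

(* [A] <= [B] iff A <_E B; independent of A and B by equot_leE *)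
Definition equot_le (c c' : equot) : bool :=
  `[< exists A B, [/\ A `<=` X, B `<=` X,
        set_val c = eclass A, set_val c' = eclass B & A <_E B] >].

Lemma eclass_eq A B : A `<=` X -> B `<=` X ->
  eclass A = eclass B <-> A =_E B.
Proof.
move=> AX BX; split=> [AB|[AB BA]].
  suff [] : eclass B A by [].
  by rewrite -AB; split=> //; split; exact: embeds_refl.
by apply/seteqP; split=> C [CX [? ?]]; split=> //; split;
  apply: embeds_trans; eassumption.
Qed.

Lemma equot_leE (c c' : equot) A B : A `<=` X -> B `<=` X ->
  set_val c = eclass A -> set_val c' = eclass B ->
  equot_le c c' <-> A <_E B.
Proof.
move=> AX BX cA cB; split=> [/asboolP[A' [B' [A'X B'X]]]|AB]; last first.
  by apply/asboolP; exists A, B.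
rewrite cA cB => /(eclass_eq AX A'X)[AA' _] /(eclass_eq BX B'X)[_ B'B] A'B'.
exact: embeds_trans AA' (embeds_trans A'B' B'B).
Qed.

Lemma equot_rep (c : equot) : exists2 A, A `<=` X & set_val c = eclass A.
Proof. by have [A AX cA] := set_valP c; exists A. Qed.

Fact equot_le_refl : reflexive equot_le.
Proof.
move=> c; have [A AX cA] := equot_rep c.
by apply/(equot_leE AX AX cA cA); exact: embeds_refl.
Qed.

Fact equot_le_anti : antisymmetric equot_le.
Proof.
move=> c c'; have [A AX cA] := equot_rep c; have [B BX cB] := equot_rep c'.
move=> /andP[/(equot_leE AX BX cA cB) AB /(equot_leE BX AX cB cA) BA].
by apply/val_inj; rewrite /= -!set_valE cA cB; apply/eclass_eq.
Qed.

Fact equot_le_trans : transitive equot_le.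
Proof.
move=> c2 c1 c3; have [A AX cA] := equot_rep c1.
have [B BX cB] := equot_rep c2; have [C CX cC] := equot_rep c3.
move=> /(equot_leE AX BX cA cB) AB /(equot_leE BX CX cB cC) BC.
by apply/(equot_leE AX CX cA cC); exact: embeds_trans AB BC.
Qed.

Fact equot_display : Order.disp_t. Proof. exact: Order.Disp tt tt. Qed.

HB.instance Definition _ := Order.Le_isPOrder.Build equot_display equot
  equot_le_refl equot_le_anti equot_le_trans.

End equot.

Definition antichain d (P : porderType d) (F : set P) :=
  forall a b, F a -> F b -> a <> b -> a >< b.

(* omega_1 as the set of points with countably many predecessors in a
   well-order of set nat *)
Section omega1_exists.

Let R : rel (set nat) := sval (well_ordering_principle (set nat)).

Let R_wo : well_order R := svalP (well_ordering_principle (set nat)).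

Let V : set (set nat) := [set x | countable [set y | R y x /\ y <> x]].

Definition omega1_model := set_type V.

Local Notation T := omega1_model.

HB.instance Definition _ := Choice.on T.

Let leT (x y : T) := R (set_val x) (set_val y).

Let R_chain : chain R predT := wo_chainW (withinW R_wo).

Let R_anti : antisymmetric R.
Proof. by move=> x y; exact: (wo_chain_antisymmetric (withinW R_wo)). Qed.

Let R_min (A : set (set nat)) : A !=set0 -> exists2 x, A x & forall y, A y -> R x y.
Proof.
move=> [x Ax]; have [|z [[/set_mem Az zA] _]] := R_wo (A := [in A]).
  by exists x; apply/mem_set.
by exists z => // y Ay; apply: zA; apply/mem_set.
Qed.

Let R_trans : transitive R.
Proof.
move=> y x z xy yz.
have [|m] := @R_min [set x; y; z]; first by exists x; left; left.
case=> [[->|->]|->] mA; first by apply: mA; right.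
  have yx : R y x by apply: mA; left; left.
  by rewrite (@R_anti x y) ?xy ?yx.
have zy : R z y by apply: mA; left; right.
by rewrite (@R_anti z y) ?yz ?zy// in mA *.
Qed.

Let leT_refl : reflexive leT.
Proof. by move=> x; have := R_chain (x := set_val x) (y := set_val x) isT isT; rewrite orbb. Qed.

Let leT_anti : antisymmetric leT.
Proof. by move=> x y /R_anti/val_inj. Qed.

Let leT_trans : transitive leT.
Proof. by move=> y x z; exact: R_trans. Qed.

Let leT_total : total leT.
Proof. by move=> x y; exact: R_chain. Qed.

Fact omega1_display : Order.disp_t. Proof. exact: Order.Disp tt tt. Qed.

HB.instance Definition _ := Order.Le_isPOrder.Build omega1_display T
  leT_refl leT_anti leT_trans.
HB.instance Definition _ := Order.POrder_isTotal.Build omega1_display T leT_total.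

Lemma omega1_exists : exists d (W : orderTopologicalType d), is_omega1 W.
Proof.
exists omega1_display, (order_topology T); split.
- apply: antisymmetric_well_order; first exact: le_anti.
  move=> A [x xA]; have [|_ [z zA <-] zmin] := @R_min [set set_val y | y in [set` A]].
    by exists (set_val x), x.
  by exists z; split=> // y yA; apply: zmin; exists y.
- rewrite (eq_countable (card_setT V)) => Vc.
  have VT x : V x.
    apply: contrapT => nVx.
    have [|m nVm mmin] := @R_min (~` V); first by exists x.
    apply: nVm; apply: sub_countable Vc; apply: subset_card_le => y [ym yNm].
    by apply: contrapT => /mmin my; apply/yNm/R_anti; rewrite ym.
  have /countable_injP[f fI] : countable [set: set nat].
    by apply: sub_countable Vc; apply: subset_card_le.
  pose D := [set n | exists2 A, f A = n & ~ A n].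
  have nD : ~ D (f D).
    by move=> DfD; have [A fAD] := DfD; rewrite (fI A D) ?in_setT.
  by apply: (nD); exists D.
- move=> x; have xV : V (set_val x) := set_valP x.
  rewrite -(eq_countable (inj_card_eq (f := set_val) _)); last first.
    by move=> y z _ _; exact: val_inj.
  apply: sub_countable xV; apply: subset_card_le => _ [y /= yx <-].
  move: yx; rewrite lt_neqAle => /andP[/eqP yx yLx].
  by split=> // /val_inj.
Qed.

End omega1_exists.

(* Main.v *)
(* An embedding of A into B, for A and B included in omega_1, fixes A on a club
   set; so if A minus B is stationary then A does not embed in B.  Ulam's matrix
   splits X into uncountably many disjoint stationary pieces T_b.  The classes
   of the T_b form an antichain, and those of the unions of the T_c over c > b
   form a descending chain. *)
Require Import Defs.
From HB Require Import structures.
From mathcomp Require Import all_boot all_order.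
From mathcomp Require Import interval all_classical topology.
Set Implicit Arguments.
Unset Strict Implicit.
Unset Printing Implicit Defensive.
Import Order.TTheory.
Local Open Scope classical_set_scope.
Local Open Scope order_scope.

(** * Closure points and the splitting of stationary sets *)

Section combinatorics.
Local Open Scope classical_set_scope.

Lemma countable_setU T (A B : set T) :
  countable A -> countable B -> countable (A `|` B).
Proof.
move=> Ac Bc; rewrite -bigcup2E; apply: bigcup_countable => //.
by case=> [//|[//|n]] _; exact: countable0.
Qed.

Lemma subsingleton_countable T (A : set T) :
  (forall x y, A x -> A y -> x = y) -> countable A.
Proof.
move=> A1; apply/countable_injP; exists (fun=> 0%N) => x y.
by rewrite !inE => Ax Ay _; exact: A1.
Qed.

Lemma subset_countable T (A B : set T) : A `<=` B -> countable B -> countable A.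
Proof. by move=> AB; apply: sub_countable; exact: subset_card_le. Qed.

Context {d : Order.disp_t} {W : orderType d} (HW : is_omega1 W).
Implicit Types (A B S : set W) (R : W -> set W) (a b x y : W).

Lemma omega1_min A : A !=set0 -> exists2 z, A z & forall y, A y -> z <= y.
Proof.
move=> [x Ax]; have [|z [[/set_mem Az zA] _]] := omega1_well_order HW (A := [in A]).
  by exists x; apply/mem_set.
by exists z => // y Ay; apply: zA; apply/mem_set.
Qed.

Lemma omega1_wf : well_founded (fun x y => x < y).
Proof.
move=> x; apply: contrapT => nx.
have [|z nz zmin] := @omega1_min [set y | ~ Acc (fun x y => x < y) y].
  by exists x.
apply: nz; constructor => y yz; apply: contrapT => /zmin.
by rewrite leNgt yz.
Qed.

(** Otherwise the countable segments up to and including the points of [A] would cover [W], making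
    it a countable union of countable sets. *)
Lemma omega1_bounded A : countable A -> exists u, forall x, A x -> x < u.
Proof.
move=> Ac; apply: contrapT => nA; apply: (omega1_uncountable HW).
have : countable (\bigcup_(x in A) ([set x] `|` [set y | y < x])).
  apply: bigcup_countable => // x _.
  by apply: countable_setU; [exact: countable1|exact: omega1_initial_countable].
apply: subset_countable => u _; apply: contrapT => nu; apply: nA; exists u.
move=> x Ax; rewrite ltNge; apply/negP; rewrite le_eqVlt => /orP[/eqP ux|ux].
  by apply: nu; exists x => //; left.
by apply: nu; exists x => //; right.
Qed.

Lemma omega1_succ x :
  exists2 s, x < s & forall y, x < y -> s <= y.
Proof.
apply: omega1_min; have [u xu] := omega1_bounded (countable1 x).
by exists u; exact: xu.
Qed.

(** The first clause excludes the least point, where the second is vacuous. It also provides a left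
    end for neighbourhoods of [a]. *)
Definition closed_under R a :=
  (exists b, b < a) /\ forall b x, b < a -> R b x -> x < a.

(* Stationarity without topology: the closed sets met are only those of closure
   points of a relation with countable sections, which form a base of the club
   filter. *)
Definition meets_closure_points S :=
  forall R, (forall b, countable (R b)) -> exists2 a, S a & closed_under R a.

Lemma meets_closure_points_sub S S' :
  S `<=` S' -> meets_closure_points S -> meets_closure_points S'.
Proof. by move=> SS' HS R /HS[a /SS' Sa aR]; exists a. Qed.

Lemma meets_closure_points_gt S u :
  meets_closure_points S -> meets_closure_points (S `&` [set x | u < x]).
Proof.
move=> HS R Rc; have [|a Sa [[b ba] aR]] := HS (fun b => R b `|` [set u]).
  by move=> b; apply: countable_setU => //; exact: countable1.
exists a; first by split=> //=; apply: (aR b) => //; right.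
by split=> [|c x ca Rcx]; [exists b|apply: (aR c) => //; left].
Qed.

(** The nonstationary ideal is countably complete: if [R n] witnesses failure for [T n], a closure
    point of the union of the [R n] is one of every [R n], so no [T n] contains it. *)
Lemma meets_closure_points_cover S (T : nat -> set W) :
  meets_closure_points S -> S `<=` \bigcup_n T n ->
  exists n, meets_closure_points (T n).
Proof.
move=> HS ST; apply: contrapT => nT.
have /choice[R HR] n : exists R, (forall b, countable (R b)) /\
    forall a, T n a -> ~ closed_under R a.
  apply: contrapT => nR; apply: nT; exists n => R Rc; apply: contrapT => nTa.
  by apply: nR; exists R; split=> // a Ta aR; apply: nTa; exists a.
have [|a Sa [a0 aR]] := HS (fun b => \bigcup_n R n b).
  by move=> b; apply: bigcup_countable => // n _; have [] := HR n.
have [n _ Ta] := ST _ Sa; have [_ /(_ a Ta)] := HR n; apply.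
by split=> // b x ba Rx; apply: (aR b) => //; exists n.
Qed.

(* Ulam's matrix: x goes into the cell (a, n) when the n-th element of
   the initial segment below x is a. *)
Lemma ulam_disjoint S : meets_closure_points S ->
  exists (I : set W) (T : W -> set W), [/\ ~ countable I,
    forall a, I a -> T a `<=` S /\ meets_closure_points (T a) &
    forall a b, I a -> I b -> T a `&` T b !=set0 -> a = b].
Proof.
move=> HS.
have /choice[f fI] x : exists f : W -> nat, {in [set y | y < x] &, injective f}.
  by apply/countable_injP; exact: omega1_initial_countable.
pose M n a := [set x | S x /\ a < x /\ f x a = n].
have /choice[n HM] a : exists n, meets_closure_points (M n a).
  apply: (meets_closure_points_cover (meets_closure_points_gt a HS)).
  by move=> x [Sx ax]; exists (f x a).
(* Pigeonhole: uncountably many [a] share one row [k], and cells of the same row are disjoint since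
   [f x] is injective below [x]. *)
have [k kc] : exists k, ~ countable [set a | n a = k].
  apply: contrapT => nk; apply: (omega1_uncountable HW).
  have : countable (\bigcup_k [set a | n a = k]).
    apply: bigcup_countable => // k _.
    by apply: contrapT => nck; apply: nk; exists k.
  by apply: subset_countable => a _; exists (n a).
exists [set a | n a = k], (M k); split=> //.
- by move=> a <-; split=> // x [].
- move=> a b _ _ [x [[_ [ax fa]] [_ [bx fb]]]].
  by apply: (fI x); rewrite ?inE// fa fb.
Qed.

(** Transfinite recursion: the values chosen before stage [b] are countably many, so they cannot
    exhaust [A]. *)
Lemma omega1_inj_uncountable A : ~ countable A ->
  exists h : W -> W, (forall b, A (h b)) /\ injective h.
Proof.
move=> Ac.
have pickP b (h : forall c, c < b -> W) :
    {a | A a & forall c (cb : c < b), h c cb <> a}.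
  apply: cid2; apply: contrapT => nA; apply: Ac.
  have cI := omega1_initial_countable HW b.
  (* Totalizes [h], with a junk value outside the segment, so that its values form an image of a
     countable set. *)
  pose g c := if pselect (c < b) is left cb then h c cb else c.
  have : countable (g @` [set c | c < b]).
    by apply: sub_countable cI; exact: card_image_le.
  apply: subset_countable => a Aa; apply: contrapT => ga; apply: nA.
  exists a => // c cb ha; apply: ga; exists c => //; rewrite /g.
  by case: pselect => // cb'; rewrite -ha (bool_irrelevance cb' cb).
pose h := Fix omega1_wf (fun=> W) (fun b h => s2val (pickP b h)).
have hE b : h b = s2val (pickP b (fun c _ => h c)).
  rewrite {1}/h Fix_eq // => x f g fg.
  by congr (s2val (pickP _ _)); apply: functional_extensionality_dep => c;
    apply: functional_extensionality_dep => cx.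
have hlt b c : c < b -> h c <> h b.
  by move=> cb; rewrite (hE b); case: (pickP b _) => /= a _ /(_ c cb).
exists h; split=> [b|b c hbc]; first by rewrite hE; case: (pickP b _).
by have [bc|cb|//] := ltgtP b c; [case: (hlt _ _ bc)|case: (hlt _ _ cb)].
Qed.

(** Reindexes Ulam's pieces by all of [W], the index set required of the descending chain. *)
Lemma omega1_disjoint_family S : meets_closure_points S ->
  exists T : W -> set W, [/\ forall b, T b `<=` S,
    forall b, meets_closure_points (T b) &
    forall b c, T b `&` T c !=set0 -> b = c].
Proof.
move=> /ulam_disjoint[I [T [/omega1_inj_uncountable[h [hI hinj]] TS Td]]].
exists (T \o h); split=> [b|b|b c Tbc]; [exact: (TS _ _).1|exact: (TS _ _).2|].
exact/hinj/Td.
Qed.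

End combinatorics.

(** * Clubs and embeddings in the order topology *)

Section topology.
Local Open Scope classical_set_scope.
Context {d : Order.disp_t} {W : orderTopologicalType d} (HW : is_omega1 W).
Implicit Types (A B S : set W) (R : W -> set W) (a b x y : W).

Lemma open_left_interval (V : set W) a : open V -> V a ->
  (exists b, b < a) -> exists2 b, b < a & forall x, b < x -> x <= a -> V x.
Proof.
move=> oV Va [b0 b0a].
have : nbhs a V by apply: open_nbhs_nbhs.
rewrite itv_nbhsE => -[[l r] [io ai] iV].
have lr x : (l <= BLeft x) -> x <= a -> V x.
  move=> lx xa; apply: iV; rewrite /= itv_boundlr lx /=.
  move: ai; rewrite itv_boundlr => /andP[_]; apply: le_trans.
  by rewrite bnd_simp.
(* A finite left end [l] is open and serves as [b]; an interval unbounded below takes [b0]. *)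
move: l io ai iV lr => [[] l|[]] // io ai iV lr.
- exists l; last by move=> x lx; apply: lr; rewrite bnd_simp.
  by move: ai; rewrite itv_boundlr => /andP[]; rewrite bnd_simp.
- by exists b0 => // x _; apply: lr; rewrite bnd_simp.
Qed.

Lemma stationary_meets_closure_points S :
  stationary S -> meets_closure_points S.
Proof.
move=> HS R Rc.
have /choice[s sP] x : exists s, x < s /\ forall y, x < y -> s <= y.
  by have [s] := omega1_succ HW x; exists s.
have [x0 _] : exists x : W, True.
  apply: contrapT => W0; apply: (omega1_uncountable HW).
  by apply: subsingleton_countable => x; case: W0; exists x.
(* The ray keeps [x0] strictly below every point of [C], as the first clause of [closed_under]
   demands. *)
pose C := [set a | forall b x, b < a -> R b x -> x < a] `&` `[s x0, +oo[.
have clC : closed C.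
  apply: closedI; last exact: rray_closed.
  (* Closure fails at [a] exactly when [b < a <= x] for some [R b x], and [a <= x] amounts to
     [a < s x]. *)
  have -> : [set a | forall b x, b < a -> R b x -> x < a] =
      ~` \bigcup_(p in [set p : W * W | R p.1 p.2]) `]p.1, s p.2[.
    apply/seteqP; split=> a /=.
      move=> aR [[b x] /= Rbx]; rewrite in_itv /= => /andP[ba ax].
      have /(sP x).2 := aR b x ba Rbx; by rewrite leNgt ax.
    move=> na b x ba Rbx; rewrite ltNge; apply/negP => ax; apply: na.
    exists (b, x) => //=; rewrite in_itv /= ba /=.
    by apply: le_lt_trans ax _; have [] := sP x.
  by rewrite closedC; apply: bigcup_open => p _; exact: itv_open.
have unC : ~ has_ubound C.
  move=> [u uC].
  have /choice[g gP] y : exists g, y < g /\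
      forall b x, b <= y -> R b x -> x < g.
    have Bc : countable (\bigcup_(b in [set y] `|` [set z | z < y]) R b).
      apply: bigcup_countable => //; apply: countable_setU.
        exact: countable1.
      exact: omega1_initial_countable.
    have [g gP] := omega1_bounded HW (countable_setU (countable1 y) Bc).
    exists g; split=> [|b x + Rbx]; first by apply: gP; left.
    rewrite le_eqVlt => by_; apply: gP; right; exists b => //.
    by case/orP: by_ => [/eqP|]; [left|right].
  (* The least upper bound [a] of the [q n] lies in [C] above [u]: any [b < a] is below some [q n],
     hence [R b] is below [q n.+1]. *)
  pose q n := iter n g (Order.max u (s x0)).
  have [|a aq amin] := @omega1_min _ _ HW (ubound (range q)).
    have [v vP] := omega1_bounded HW
      (sub_countable (card_image_le q setT) (countableP _)).
    by exists v => x /vP/ltW.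
  have qlt n : q n < a.
    apply: (@lt_le_trans _ _ (q n.+1)); first by have [] := gP (q n).
    by apply: aq; exists n.+1.
  have /uC : C a.
    split=> [b x ba Rbx|/=]; last first.
      rewrite in_itv /= andbT; apply: (le_trans _ (ltW (qlt 0%N))).
      by rewrite le_max lexx orbT.
    have [n bq] : exists n, b < q n.
      apply: contrapT => nb; move: ba; rewrite ltNge => /negP; apply.
      apply: amin => _ [n _ <-]; rewrite leNgt; apply/negP => bq.
      by apply: nb; exists n.
    apply: (lt_trans _ (qlt n.+1)); have [_] := gP (q n).
    by move=> /(_ b x (ltW bq)); exact.
  rewrite leNgt => /negP; apply; apply: le_lt_trans (qlt 0%N).
  by rewrite le_max lexx.
have [a [Sa [aR /=]]] := HS _ clC unC; rewrite in_itv /= andbT => x0a.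
exists a => //; split=> //; exists x0.
by apply: lt_le_trans x0a; have [] := sP x0.
Qed.

(* A continuous injection f of a stationary A into omega_1 fixes every closure
   point a of f, of its inverse and of "next element of A": f a = b < a would
   bound a = f^-1 b below a, and a < f a is impossible since a is the limit of
   points x < a of A with f x < a. *)
Lemma not_embeds A B : meets_closure_points (A `\` B) -> ~ (A <_E B).
Proof.
move=> HAB /embedsP[f [fI cf _]].
pose R1 b := [set x | exists2 z : A, set_val z = b & set_val (f z) = x].
pose R2 b := [set x | exists2 z : A, set_val (f z) = b & set_val z = x].
pose R3 b := [set x | [/\ A x, b < x & forall y, A y -> b < y -> x <= y]].
have [|a [Aa nBa] [a0 aR]] := HAB (fun b => R1 b `|` (R2 b `|` R3 b)).
  move=> b; do ![apply: countable_setU]; apply: subsingleton_countable.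
  - move=> _ _ [z zb <-] [t tb <-]; congr (set_val (f _)).
    by apply: val_inj; rewrite /= -!set_valE zb.
  - move=> _ _ [z zb <-] [t tb <-]; congr set_val.
    by apply/fI/val_inj; rewrite /= -!set_valE zb.
  - move=> x y [Ax bx xmin] [Ay by_ ymin]; apply/le_anti.
    by rewrite xmin// ymin.
pose za : A := exist _ a (mem_set Aa).
have [fa|fa|fa] := ltgtP (set_val (f za)) a.
- suff: a < a by rewrite ltxx.
  by apply: (aR _ _ fa); right; left; exists za.
- have cF : continuous (set_val \o f).
    move=> z; apply: (@continuous_comp A B W f set_val); first exact: cf.
    exact: initial_continuous.
  have [V oV Vf] : open ((set_val \o f) @^-1` `]a, +oo[).
    by move/continuousP: cF; apply; exact: rray_open.
  have Va : V a.
    have : (set_val @^-1` V) za by rewrite Vf /= in_itv /= fa.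
    by [].
  have [b ba bV] := open_left_interval oV Va a0.
  have [|x [Ax bx] xmin] := @omega1_min _ _ HW [set x | A x /\ b < x].
    by exists a.
  have xa : x < a.
    apply: (aR b) => //; right; right; split=> // y Ay by_.
    by apply: xmin.
  pose zx : A := exist _ x (mem_set Ax).
  have : (set_val @^-1` V) zx by apply: bV => //; exact: ltW.
  rewrite Vf /= in_itv /= andbT ltNge => /negP; apply; apply: ltW.
  by apply: (aR x) => //; left; exists zx.
- by apply: nBa; rewrite -fa; exact: set_valP.
Qed.

End topology.

(** * Classes of subsets under biembedding *)

Section equot.
Local Open Scope classical_set_scope.
Context {T : topologicalType} (X : set T).

Lemma embeds_subset (A B : set T) : A `<=` B -> A <_E B.
Proof.
move=> AB; apply/embedsP.
pose f (z : A) : B := exist _ (set_val z) (mem_set (AB _ (set_valP z))).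
exists f; split.
- by move=> x y fxy; apply: val_inj; exact: (congr1 val fxy).
- apply/continuousP => _ [V oV <-]; by exists V.
- by move=> _ [V oV <-]; exists (set_val @^-1` V) => //; exists V.
Qed.

(** Intersecting with [X] makes the class map total; subsets of [X] are unchanged. *)
Definition to_equot (A : set T) : equot X :=
  exist _ (eclass X (A `&` X)) (mem_set
    (ex_intro2 _ _ (A `&` X) (@subIsetr _ A X) (erefl (eclass X (A `&` X))))).

Lemma to_equot_le (A B : set T) : A `<=` X -> B `<=` X ->
  (to_equot A <= to_equot B) <-> A <_E B.
Proof.
move=> AX BX; rewrite -{2}(setIidl AX) -{2}(setIidl BX).
by apply: equot_leE => //; exact: subIsetr.
Qed.

End equot.

Theorem theorem17 (d : Order.disp_t) (W : orderTopologicalType d)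
    (HW : is_omega1 W) (X : set W) (HX : stationary X) :
  (exists F : set (equot X), antichain F /\ ~ countable F) /\
  (exists c : W -> equot X, forall beta gamma : W, beta < gamma ->
     c gamma <= c beta /\ c gamma <> c beta).
Proof.
have [T [TX HT Td]] := omega1_disjoint_family HW
  (stationary_meets_closure_points HW HX).
have Tle b c : b <> c -> ~ (to_equot X (T b) <= to_equot X (T c)).
  move=> bc /(to_equot_le (TX b) (TX c)); apply: (not_embeds HW).
  apply: meets_closure_points_sub (HT b) => x Tbx; split=> // Tcx.
  by apply/bc/Td; exists x.
split.
  exists (range (to_equot X \o T)); split.
    move=> _ _ [b _ <-] [c _ <-] /= bc.
    have {}bc : b <> c by move=> /(congr1 (to_equot X \o T)).
    by rewrite /Order.comparable negb_or; apply/andP; split; apply/negP;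
      apply: Tle => // /esym.
  (* Equal classes are comparable, so [Tle] makes the indexing injective. *)
  rewrite (eq_countable (inj_card_eq _)); first exact: omega1_uncountable HW.
  move=> b c _ _ /= bc; apply: contrapT => /Tle; apply.
  by rewrite bc lexx.
pose A b := \bigcup_(c in [set c | b < c]) T c.
have AX b : A b `<=` X by move=> x [c _ /TX].
exists (to_equot X \o A) => b c bc /=; split.
  apply/(to_equot_le (AX c) (AX b)); apply: embeds_subset.
  by move=> x [e /= ce Tx]; exists e => //=; exact: lt_trans ce.
move=> cb; have /(to_equot_le (AX b) (AX c)) : to_equot X (A b) <= to_equot X (A c).
  by rewrite cb lexx.
(* The piece [T c] lies in [A b] but is disjoint from [A c], whose indices are strictly above
   [c]. *)
apply: (not_embeds HW); apply: meets_closure_points_sub (HT c) => x Tx.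
split; first by exists c.
move=> [e /= ce Te]; have ec : c = e by apply: Td; exists x.
by move: ce; rewrite ec ltxx.
Qed.
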